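(* Let $\mathbb{C}^3$ have orthonormal basis $f,e_1,e_2$. For $i=1,2$, let $\theta_i\in(0,\pi/2)$ and set $c_i=\cos\theta_i$, $s_i=\sin\theta_i$. Define $$A_1=e_1f^*,\qquad A_2=e_2f^*,\qquad A_3=(c_1e_1+s_1e_2)f^*,\qquad A_4=(c_2e_1+is_2e_2)f^*,$$ where $i$ in the formula for $A_4$ is the imaginary unit. Let $$u_1=\begin{bmatrix} 1 \\ 0 \\ c_1 \\ c_2 \end{bmatrix},\qquad u_2=\begin{bmatrix} 0 \\ 1 \\ s_1 \\ i s_2 \end{bmatrix}\in\mathbb{C}^4,$$ and let $f_1=(\alpha_1,\alpha_2,\alpha_3,\alpha_4)^t$ and $f_2=(\beta_1,\beta_2,\beta_3,\beta_4)^t$ be the orthogonal unit vectors obtained by applying the Gram--Schmidt process to $u_1,u_2$. Let $$p(z)=\begin{bmatrix} \bar\alpha_1z_1+\bar\alpha_2z_2+\bar\alpha_3z_3+\bar\alpha_4z_4 \\ \bar\beta_1z_1+\bar\beta_2z_2+\bar\beta_3z_3+\bar\beta_4z_4 \end{bmatrix}.$$ Then $$\|p\|_\infty=\sup_{|z_1|=|z_2|=|z_3|=|z_4|=1}\|p(z)\|<2=\|p(A_1,A_2,A_3,A_4)\|.$$ So the matrix von Neumann inequality fails for $(A_1,A_2,A_3,A_4)$.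
   Context: For vectors $v,w$ in a complex inner product space, $vw^*$ denotes the operator $x\mapsto\langle x,w\rangle v$, where the inner product is linear in the first variable. For a matrix $p=[p_{ij}]$ of complex polynomials in $n$ variables, $\|p\|_\infty=\sup\{\|[p_{ij}(z)]\|: z\in\mathbb{C}^n,\ |z_k|\le 1 \text{ for all } k\}$, with the operator norm on scalar matrices (for a column vector this is the Euclidean norm). For commuting operators $A_1,\dots,A_n$ on $\mathcal{H}$, $p(A_1,\dots,A_n)=[p_{ij}(A_1,\dots,A_n)]$ is regarded as an operator between direct sums of copies of $\mathcal{H}$, with the operator norm; in particular for a $2\times1$ column $p$ and $\mathcal{H}=\mathbb{C}^3$ it is an operator $\mathbb{C}^3\to\mathbb{C}^3\oplus\mathbb{C}^3$. The matrix von Neumann inequality for $(A_1,\dots,A_n)$ is the statement that $\|p(A_1,\dots,A_n)\|\le\|p\|_\infty$ for every matrix $p$ of polynomials. *)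

(* Defs.v *)
From HB Require Import structures.
From mathcomp Require Import all_boot all_order all_algebra.
From mathcomp Require Import spectral complex.
From mathcomp Require Import all_classical all_reals all_analysis.
(* The notations of [mpoly] clash with those of MathComp-Analysis. *)
From mathcomp Require Import -(notations) mpoly.

Set Implicit Arguments.
Unset Strict Implicit.
Unset Printing Implicit Defensive.

Import Order.TTheory GRing.Theory Num.Theory.

Local Open Scope classical_set_scope.
Local Open Scope ring_scope.
Local Open Scope sesquilinear_scope.
Local Open Scope complex_scope.

Section InnerProduct.
Variable R : realType.
Local Notation C := R[i].

(* Vectors are columns, so that a matrix acts as an operator by [M *m x].
   The inner product is linear in the first variable. *)
Definition inner n (v w : 'cV[C]_n) : C := (w ^t* *m v) 0 0.

(* <v, v> is a nonnegative element of C; [Re] only moves it to R. *)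
Definition norm2 n (v : 'cV[C]_n) : R := Num.sqrt (complex.Re (inner v v)).

Definition orthonormal_seq n (s : seq 'cV[C]_n) : Prop :=
  forall i j, (i < size s)%N -> (j < size s)%N ->
    inner s`_i s`_j = (i == j)%:R.

(* v w^* : x |-> <x, w> v; see [rank1E]. *)
Definition rank1 m n (v : 'cV[C]_m) (w : 'cV[C]_n) : 'M[C]_(m, n) := v *m w ^t*.

Lemma rank1E m n (v : 'cV[C]_m) (w x : 'cV[C]_n) :
  rank1 v w *m x = inner x w *: v.
Proof.
rewrite /rank1 /inner -mulmxA; apply/matrixP => i j.
by rewrite !mxE big_ord1 !ord1 mulrC !mxE.
Qed.

Definition normalize n (v : 'cV[C]_n) : 'cV[C]_n := (norm2 v)^-1%:C *: v.

Definition gram_schmidt n (us : seq 'cV[C]_n) : seq 'cV[C]_n :=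
  foldl (fun fs u => rcons fs (normalize (u - \sum_(g <- fs) inner u g *: g)))
    [::] us.

(* The set is nonempty and bounded above, so this [sup] is a genuine one; the
   same holds for the suprema of norms of polynomials on the polydisc below. *)
Definition opnorm m n (M : 'M[C]_(m, n)) : R :=
  sup [set norm2 (M *m x) | x in [set x : 'cV[C]_n | norm2 x <= 1]].

End InnerProduct.

Section PolynomialMatrices.
Variable R : realType.
Local Notation C := R[i].

Definition peval n k l (p : 'M[mpoly n C]_(k, l)) (z : 'I_n -> C) :
  'M[C]_(k, l) := \matrix_(i, j) meval z (p i j).

Definition polydisc n : set ('I_n -> C) := [set z | forall k, `|z k| <= 1].

Definition torus n : set ('I_n -> C) := [set z | forall k, `|z k| = 1].

Definition psup n k l (D : set ('I_n -> C)) (p : 'M[mpoly n C]_(k, l)) : R :=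
  sup [set opnorm (peval p z) | z in D].

Definition pnorm n k l (p : 'M[mpoly n C]_(k, l)) : R := psup (@polydisc n) p.

(* q(A_1, ..., A_n) for a scalar polynomial q; the factors of each monomial are
   multiplied in the order of their indices, which is irrelevant when the A_i
   commute. *)
Definition op_eval n d (q : mpoly n C) (A : 'I_n -> 'M[C]_d.+1) : 'M[C]_d.+1 :=
  mmap (@scalar_mx C d.+1) A q.

(* [p_ij(A_1, ..., A_n)], an operator from l to k copies of C^(d+1). *)
Definition op_peval n d k l (p : 'M[mpoly n C]_(k, l))
    (A : 'I_n -> 'M[C]_d.+1) :
    'M[C]_(\sum_(i < k) d.+1, \sum_(j < l) d.+1) :=
  \mxblock_(i < k, j < l) op_eval (p i j) A.

(* Meant for commuting tuples A. *)
Definition matrix_von_neumann n d (A : 'I_n -> 'M[C]_d.+1) : Prop :=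
  forall k l (p : 'M[mpoly n C]_(k, l)), opnorm (op_peval p A) <= pnorm p.

End PolynomialMatrices.

(* Main.v *)
(* With [f1], [f2] orthonormal, [|p(z)|^2] is the squared norm of the projection
   of [z] on the span of [u1] and [u2], that is [|z|^2 - |z - w|^2] for the
   projection [w]; on the torus [|z|^2 = 4].  The span contains no unimodular
   vector: if all entries of [a u1 + b u2] had modulus 1, the third and fourth
   entries would force the real and imaginary parts of [a b^*] to vanish.  A
   quantitative form of this bounds [|z - w|] below on the torus.  On the other
   hand [A_j = v_j f^*] with [v_j = (u1)_j e1 + (u2)_j e2], so [p(A) x] is
   [<x, f>] times a vector whose squared norm is the sum of all
   [|<u_i, f_k>|^2], namely [|u1|^2 + |u2|^2 = 4]. *)

Require Import Defs.
From HB Require Import structures.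
From mathcomp Require Import all_boot all_order all_algebra.
From mathcomp Require Import spectral complex.
From mathcomp Require Import all_classical all_reals all_analysis.
From mathcomp Require Import -(notations) mpoly.
From mathcomp Require Import ring lra.

Import Order.TTheory GRing.Theory Num.Theory.
Local Open Scope classical_set_scope.
Local Open Scope ring_scope.
Local Open Scope complex_scope.

Section ComplexVectors.
Set Implicit Arguments.
Unset Strict Implicit.
Unset Printing Implicit Defensive.
Variable R : realType.
Local Notation C := R[i].

(** * Inner products and norms of complex columns *)

Lemma innerE n (v w : 'cV[C]_n) : inner v w = \sum_j v j 0 * (w j 0)^*.
Proof. by rewrite /inner mxE; apply: eq_bigr => j _; rewrite !mxE mulrC. Qed.

Lemma innerDl n (v v' w : 'cV[C]_n) :
  inner (v + v') w = inner v w + inner v' w.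
Proof. by rewrite /inner mulmxDr mxE. Qed.

Lemma innerZl n (k : C) (v w : 'cV[C]_n) : inner (k *: v) w = k * inner v w.
Proof. by rewrite /inner -scalemxAr mxE. Qed.

Lemma innerC n (v w : 'cV[C]_n) : inner v w = (inner w v)^*.
Proof.
rewrite !innerE rmorph_sum; apply: eq_bigr => j _.
by rewrite rmorphM /= conjcK mulrC.
Qed.

Lemma innerDr n (v w w' : 'cV[C]_n) :
  inner v (w + w') = inner v w + inner v w'.
Proof. by rewrite !(innerC v) innerDl rmorphD. Qed.

Lemma innerZr n (k : C) (v w : 'cV[C]_n) : inner v (k *: w) = k^* * inner v w.
Proof. by rewrite !(innerC v) innerZl rmorphM. Qed.

Lemma innerNl n (v w : 'cV[C]_n) : inner (- v) w = - inner v w.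
Proof. by rewrite -scaleN1r innerZl mulN1r. Qed.

Lemma innerNr n (v w : 'cV[C]_n) : inner v (- w) = - inner v w.
Proof. by rewrite !(innerC v) innerNl rmorphN. Qed.

Definition inner_lin := (innerDl, innerDr, innerNl, innerNr, innerZl, innerZr).

Lemma innervv n (v : 'cV[C]_n) : inner v v = \sum_j `|v j 0| ^+ 2.
Proof. by rewrite innerE; apply: eq_bigr => j _; rewrite sqr_normc. Qed.

Lemma inner_ge0 n (v : 'cV[C]_n) : 0 <= inner v v.
Proof. by rewrite innervv sumr_ge0 // => j _; rewrite exprn_ge0. Qed.

Lemma norm2_ge0 n (v : 'cV[C]_n) : 0 <= norm2 v.
Proof. exact: sqrtr_ge0. Qed.

Lemma sqr_norm2 n (v : 'cV[C]_n) : (norm2 v ^+ 2)%:C = inner v v.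
Proof.
have := inner_ge0 v; rewrite /norm2; case: (inner v v) => a b.
by rewrite lecE /= => /andP[/eqP -> a0]; rewrite sqr_sqrtr.
Qed.

(** Passing to squares lets norm estimates be proved in [C], where [inner] is sesquilinear and no
    square root occurs. *)
Lemma norm2_le n (v : 'cV[C]_n) (r : R) : 0 <= r ->
  (norm2 v <= r) = (inner v v <= (r ^+ 2)%:C).
Proof. by move=> r0; rewrite -sqr_norm2 lecR ler_sqr ?nnegrE ?norm2_ge0. Qed.

Lemma norm2_eq n (v : 'cV[C]_n) (r : R) : 0 <= r ->
  inner v v = (r ^+ 2)%:C -> norm2 v = r.
Proof.
move=> r0; rewrite -sqr_norm2 => /complexI /eqP.
by rewrite eqrXn2 ?norm2_ge0 // => /eqP.
Qed.

Lemma norm2_eq0 n (v : 'cV[C]_n) : norm2 v = 0 -> v = 0.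
Proof.
move=> v0; have /eqP := sqr_norm2 v.
rewrite v0 expr0n innervv eq_sym psumr_eq0 => [/allP v_eq0|j _]; last first.
  by rewrite exprn_ge0.
apply/colP => j; rewrite mxE; apply/eqP.
by have := v_eq0 j (mem_index_enum j); rewrite sqrf_eq0 normr_eq0.
Qed.

Lemma norm2Z n (k : C) (v : 'cV[C]_n) :
  (norm2 (k *: v))%:C = `|k| * (norm2 v)%:C.
Proof.
apply: (@pexpIrn _ 2);
  rewrite ?nnegrE ?mulr_ge0 ?normr_ge0 ?ler0c ?norm2_ge0 //.
by rewrite exprMn sqr_normc -!rmorphXn /= !sqr_norm2 innerZl innerZr mulrA.
Qed.

Lemma inner_normalize n (v : 'cV[C]_n) : v != 0 ->
  inner (normalize v) (normalize v) = 1.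
Proof.
move=> v0; rewrite -sqr_norm2 -[X in X ^+ 2](_ : 1 = _) ?expr1n //.
apply: complexI; rewrite norm2Z.
have nv0 : norm2 v != 0 by apply: contra v0 => /eqP/norm2_eq0 ->.
rewrite ger0_norm ?ler0c ?invr_ge0 ?norm2_ge0 //.
by rewrite -rmorphM /= mulVf.
Qed.

Lemma normalizeK n (v : 'cV[C]_n) : v = (norm2 v)%:C *: normalize v.
Proof.
have [v0|nv0] := eqVneq (norm2 v) 0; first by rewrite v0 scale0r (norm2_eq0 v0).
by rewrite scalerA -rmorphM /= mulfV // scale1r.
Qed.

(** * Gram-Schmidt for two vectors and orthogonal projections *)

(** The hypotheses express linear independence. The triangular relations with nonzero diagonal
    coefficients [a] and [b] can be inverted, so both pairs span the same plane. *)
Lemma gram_schmidt2 n (u1 u2 : 'cV[C]_n) (fs := gram_schmidt [:: u1; u2])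
    (f1 := fs`_0) (f2 := fs`_1) :
  u1 != 0 -> (forall k, u2 != k *: u1) ->
  [/\ inner f1 f1 = 1, inner f2 f2 = 1, inner f1 f2 = 0 &
    exists a b c, [/\ a != 0, b != 0, u1 = a *: f1 & u2 = b *: f2 + c *: f1]].
Proof.
move=> u1_neq0 u2_neq.
have f1E : f1 = normalize u1.
  by rewrite /f1 /fs /gram_schmidt /= big_nil subr0.
have f2E : f2 = normalize (u2 - inner u2 f1 *: f1).
  by rewrite /f2 /fs /gram_schmidt /= big_seq1 big_nil subr0 -f1E.
clearbody f1 f2; set v := u2 - _ in f2E.
have v_neq0 : v != 0.
  by rewrite subr_eq0 f1E scalerA u2_neq.
have norm_neq0 (w : 'cV[C]_n) : w != 0 -> (norm2 w)%:C != 0.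
  by apply: contra => /eqP/(@complexI _ _ 0)/norm2_eq0 ->.
have f11 : inner f1 f1 = 1 by rewrite f1E inner_normalize.
split=> //.
- by rewrite f2E inner_normalize.
- rewrite f2E innerZr /v innerDr innerNr innerZr (innerC f1 u2) f11 mulr1.
  by rewrite subrr mulr0.
exists (norm2 u1)%:C, (norm2 v)%:C, (inner u2 f1); split; try exact: norm_neq0.
- by rewrite f1E -normalizeK.
- by rewrite f2E -normalizeK subrK.
Qed.

(** Pythagoras: [z - w] is orthogonal to the span of [f1] and [f2]. *)
Lemma inner_sub_proj n (f1 f2 z : 'cV[C]_n)
    (w := inner z f1 *: f1 + inner z f2 *: f2) :
  inner f1 f1 = 1 -> inner f2 f2 = 1 -> inner f1 f2 = 0 ->
  inner z z = inner (z - w) (z - w) + (`|inner z f1| ^+ 2 + `|inner z f2| ^+ 2).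
Proof.
move=> f11 f22 f12; have f21 : inner f2 f1 = 0 by rewrite innerC f12 rmorph0.
rewrite /w !inner_lin f11 f22 f12 f21 (innerC f1 z) (innerC f2 z) !sqr_normc.
move: (inner z z) (inner z f1) (inner z f2) => zz a b.
by move: (a^*) (b^*) => a' b'; ring.
Qed.

Lemma cauchy_schwarz1 n (f z : 'cV[C]_n) : inner f f = 1 ->
  `|inner z f| ^+ 2 <= inner z z.
Proof.
move=> f11; rewrite -subr_ge0.
suff -> : inner z z - `|inner z f| ^+ 2 =
    inner (z - inner z f *: f) (z - inner z f *: f) by exact: inner_ge0.
rewrite !inner_lin f11 (innerC f z) sqr_normc.
by move: (inner z z) (inner z f) => zz a; move: (a^*) => a'; ring.
Qed.

Lemma inner_comb2 n (f1 f2 : 'cV[C]_n) a b :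
  inner f1 f1 = 1 -> inner f2 f2 = 1 -> inner f1 f2 = 0 ->
  inner (a *: f1 + b *: f2) (a *: f1 + b *: f2) = `|a| ^+ 2 + `|b| ^+ 2.
Proof.
move=> f11 f22 f12; have f21 : inner f2 f1 = 0 by rewrite innerC f12 rmorph0.
rewrite !inner_lin f11 f22 f12 f21 !sqr_normc.
by rewrite !(mulr0, mulr1, addr0, add0r).
Qed.

(** By the parallelogram identity, the squared norm of a midpoint is the mean of the two squared
    norms minus a nonnegative term. *)
Lemma inner_half_le n (x y : 'cV[C]_n) (M : C) :
  inner x x <= M -> inner y y <= M ->
  inner (2^-1 *: (x + y)) (2^-1 *: (x + y)) <= M.
Proof.
move=> xM yM; have xy := inner_ge0 (x - y).
have -> : inner (2^-1 *: (x + y)) (2^-1 *: (x + y)) =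
    2^-1 * (inner x x + inner y y) - 4^-1 * inner (x - y) (x - y).
  by rewrite !inner_lin fmorphV rmorph_nat; field.
rewrite lerBlDr (@le_trans _ _ M) ?lerDl ?mulr_ge0 ?invr_ge0 ?ler0n //.
rewrite ler_pdivrMl ?ltr0n //.
by rewrite mulr_natl mulr2n lerD.
Qed.

(** * Operator norms *)

Lemma opnorm_eq m n (M : 'M[C]_(m, n)) (r : R) (x0 : 'cV[C]_n) :
  (forall x, norm2 (M *m x) <= r * norm2 x) -> 0 <= r ->
  norm2 x0 = 1 -> norm2 (M *m x0) = r -> opnorm M = r.
Proof.
move=> Mr r0 x01 Mx0.
have ubr : ubound [set norm2 (M *m x) | x in [set x | norm2 x <= 1]] r.
  move=> _ [x /= x1 <-]; apply: le_trans (Mr x) _.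
  by rewrite ler_piMr.
apply/eqP; rewrite eq_le; apply/andP; split.
  by apply: ge_sup => //; exists r; exists x0 => //=; rewrite x01.
apply: ub_le_sup; first by exists r.
by exists x0 => //=; rewrite x01.
Qed.

(** A column acts on one-entry vectors by scaling itself, so its operator norm is attained at
    [1]. *)
Lemma opnorm_col m (M : 'cV[C]_m) : opnorm M = norm2 M.
Proof.
have Mx (x : 'cV[C]_1) : M *m x = x 0 0 *: M.
  by apply/colP => j; rewrite !mxE big_ord1 mulrC.
have nx (x : 'cV[C]_1) : (norm2 x)%:C = `|x 0 0|.
  apply: (@pexpIrn _ 2); rewrite ?nnegrE ?normr_ge0 ?ler0c ?norm2_ge0 //.
  by rewrite -rmorphXn /= sqr_norm2 innervv big_ord1.
have nMx (x : 'cV[C]_1) : norm2 (M *m x) = norm2 M * norm2 x.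
  by apply: complexI; rewrite Mx norm2Z -nx -rmorphM mulrC.
have n1 : norm2 (1%:M : 'cV[C]_1) = 1.
  by apply: complexI; rewrite nx mxE eqxx normr1.
apply: (@opnorm_eq _ _ _ _ 1%:M); rewrite ?norm2_ge0 ?n1 //.
- by move=> x; rewrite nMx.
- by rewrite nMx n1 mulr1.
Qed.

(** * Columns of two linear polynomials *)

(** The conjugates turn row [k] into [z |-> <z, f_k>]; for the Gram-Schmidt vectors this is the [p]
    of the theorem. *)
Definition lin_poly n (f1 f2 : 'cV[C]_n) : 'cV[mpoly n C]_2 :=
  \col_k \sum_(j < n) ([:: f1; f2]`_k j 0)^* *: mpolyX C (mnm1 j).

Lemma peval_lin_poly n (f1 f2 : 'cV[C]_n) (z : 'I_n -> C) (k : 'I_2) :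
  peval (lin_poly f1 f2) z k 0 = inner (\col_j z j) [:: f1; f2]`_k.
Proof.
rewrite !mxE raddf_sum innerE; apply: eq_bigr => j _ /=.
by rewrite mevalZ mevalXU mxE mulrC.
Qed.

Lemma peval_lin_poly_half n (f1 f2 : 'cV[C]_n) (x y : 'I_n -> C) :
  peval (lin_poly f1 f2) (fun j => 2^-1 * (x j + y j)) =
  2^-1 *: (peval (lin_poly f1 f2) x + peval (lin_poly f1 f2) y).
Proof.
apply/matrixP => k l; rewrite ord1 peval_lin_poly.
rewrite [RHS]mxE [X in _ * X]mxE !peval_lin_poly -innerDl -innerZl.
by congr inner; apply/colP => j; rewrite !mxE.
Qed.

Lemma inner_peval n (f1 f2 : 'cV[C]_n) (z : 'I_n -> C) (Z := \col_j z j) :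
  inner (peval (lin_poly f1 f2) z) (peval (lin_poly f1 f2) z) =
  `|inner Z f1| ^+ 2 + `|inner Z f2| ^+ 2.
Proof.
by rewrite innervv big_ord_recl big_ord1 !peval_lin_poly.
Qed.

(** * Polydisc and torus *)

(** The chord of the unit circle through [z] perpendicular to the direction [t = z / |z|] is
    bisected by [z]; its ends are [t (|z| + i s)] and [t (|z| - i s)] with [s ^+ 2 = 1 - |z| ^+ 2].
    For [z = 0] any diameter works. *)
Lemma unit_midpoint (z : C) : `|z| <= 1 ->
  exists xy : C * C, [/\ `|xy.1| = 1, `|xy.2| = 1 & z = 2^-1 * (xy.1 + xy.2)].
Proof.
move=> z1; have [->|z0] := eqVneq z 0.
  by exists (1, -1); rewrite /= normrN normr1 subrr mulr0.
have r0 : `|z| != 0 by rewrite normr_eq0.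
have rR : `|z| \is Num.real by exact: normr_real.
have s0 : 0 <= 1 - `|z| ^+ 2 by rewrite subr_ge0 expr_le1.
pose s := sqrtC (1 - `|z| ^+ 2).
have sR : s \is Num.real by rewrite ger0_real // sqrtC_ge0.
have t1 : `|z / `|z| | = 1 by rewrite normrM normfV normr_id mulfV.
have unit_rect x y : x \is Num.real -> y \is Num.real ->
    x ^+ 2 + y ^+ 2 = 1 -> `|x + Num.imaginary * y : C| = 1.
  move=> xR yR xy; apply: (@pexpIrn _ 2); rewrite ?nnegrE ?normr_ge0 //.
  by rewrite normC2_rect // xy expr1n.
have ss : `|z| ^+ 2 + s ^+ 2 = 1 by rewrite /s sqrtCK addrC subrK.
exists (z / `|z| * (`|z| + Num.imaginary * s),
        z / `|z| * (`|z| + Num.imaginary * - s)); split=> /=.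
- by rewrite normrM t1 mul1r unit_rect.
- by rewrite normrM t1 mul1r unit_rect ?rpredN // sqrrN.
- move: (s) (Num.imaginary) r0 => s' i'; move: (`|z|) => r r0; by field.
Qed.

Lemma torus_nonempty n : @torus R n !=set0.
Proof. by exists (fun=> 1) => k; rewrite normr1. Qed.

Lemma torus_sub_polydisc n : @torus R n `<=` @polydisc R n.
Proof. by move=> z zT k; rewrite zT. Qed.

Lemma polydisc_midpoint n (z : 'I_n -> C) : polydisc z ->
  exists x y : 'I_n -> C,
    [/\ torus x, torus y & z = fun j => 2^-1 * (x j + y j)].
Proof.
move=> zD; have /choice[g gP] j := unit_midpoint (zD j).
exists (fun j => (g j).1), (fun j => (g j).2); split.
- by move=> j; have [] := gP j.
- by move=> j; have [] := gP j.
- by apply/funext => j; have [] := gP j.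
Qed.

Section Orthonormal.
Variables (n : nat) (f1 f2 : 'cV[C]_n).
Hypotheses (f11 : inner f1 f1 = 1) (f22 : inner f2 f2 = 1).
Hypothesis f12 : inner f1 f2 = 0.
Local Notation p := (lin_poly f1 f2).

(** Bessel's inequality, with [|z| ^+ 2 <= n] on the polydisc. The bound makes the suprema over the
    polydisc and the torus genuine. *)
Lemma opnorm_peval_polydisc (z : 'I_n -> C) : polydisc z ->
  opnorm (peval p z) <= Num.sqrt n%:R.
Proof.
move=> zD; rewrite opnorm_col norm2_le ?sqrtr_ge0 // sqr_sqrtr ?ler0n //.
rewrite inner_peval.
have := inner_sub_proj (\col_j z j) f11 f22 f12.
set w := _ - _ => zE.
have : inner (\col_j z j) (\col_j z j) <= n%:R.
  rewrite innervv -[X in X%:R]card_ord -sumr_const ler_sum // => j _.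
  by rewrite mxE expr_le1 // zD.
rewrite zE rmorph_nat; apply: le_trans.
by rewrite lerDr inner_ge0.
Qed.

Lemma has_ubound_opnorm_peval (D : set ('I_n -> C)) : D `<=` @polydisc R n ->
  has_ubound [set opnorm (peval p z) | z in D].
Proof.
move=> DD; exists (Num.sqrt n%:R) => _ [z /DD zD <-].
exact: opnorm_peval_polydisc.
Qed.

(* Each point of the polydisc is the midpoint of two points of the torus, and
   [p] is linear: a one-step maximum principle. *)
Lemma pnorm_lin_poly : pnorm p = psup (@torus R n) p.
Proof.
have le_torus z : torus z -> opnorm (peval p z) <= psup (@torus R n) p.
  move=> zT; apply: ub_le_sup; last by exists z.
  exact/has_ubound_opnorm_peval/torus_sub_polydisc.
have T0 := torus_nonempty n.
apply/eqP; rewrite eq_le; apply/andP; split.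
  apply: ge_sup.
    by case: T0 => z /torus_sub_polydisc zD; exists (opnorm (peval p z)), z.
  move=> _ [z zD <-].
  have [x [y [xT yT ->]]] := polydisc_midpoint zD.
  have s0 : 0 <= psup (@torus R n) p.
    by apply: le_trans (le_torus x xT); rewrite opnorm_col norm2_ge0.
  have le_sqr t : torus t -> inner (peval p t) (peval p t) <=
      (psup (@torus R n) p ^+ 2)%:C.
    by move=> /le_torus; rewrite opnorm_col norm2_le.
  rewrite opnorm_col norm2_le // peval_lin_poly_half.
  by apply: inner_half_le; exact: le_sqr.
apply: ge_sup; first by case: T0 => z zT; exists (opnorm (peval p z)), z.
move=> _ [z zT <-]; apply: ub_le_sup; first exact: has_ubound_opnorm_peval.
by exists z => //; apply: torus_sub_polydisc.
Qed.

(** On the torus [z] has squared norm [n], so by Pythagoras a gap [e] from the span caps the squared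
    norm of [p(z)] at [n - e]. Since [e] does not depend on [z], the supremum stays strictly below
    without a compactness argument. *)
Lemma psup_torus_lt (e : R) : 0 < e -> (0 < n)%N ->
  (forall z a b, torus z ->
     let w := \col_j z j - (a *: f1 + b *: f2) in e%:C <= inner w w) ->
  psup (@torus R n) p < Num.sqrt n%:R.
Proof.
move=> e0 n0 dist; have n0' : 0 < n%:R :> R by rewrite ltr0n.
apply: (@le_lt_trans _ _ (Num.sqrt (n%:R - e))); last first.
  by rewrite ltr_sqrt // gtrBl.
have le z : torus z ->
    inner (peval p z) (peval p z) <= (n%:R - e)%:C.
  move=> zT; rewrite inner_peval.
  have := inner_sub_proj (\col_j z j) f11 f22 f12.
  have := dist z (inner (\col_j z j) f1) (inner (\col_j z j) f2) zT.
  rewrite /=; set w := _ - _ => ew zE.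
  have zn : inner (\col_j z j) (\col_j z j) = n%:R.
    rewrite innervv -[X in X%:R]card_ord -sumr_const.
    by apply: eq_bigr => j _; rewrite mxE zT expr1n.
  rewrite rmorphB /= rmorph_nat -zn zE.
  by rewrite lerBrDl lerD2r.
(* [Num.sqrt] sends negative numbers to 0, so squaring it back needs [e <= n]; any point of the
   torus shows this. *)
have ne0 : 0 <= n%:R - e.
  have [z zT] := torus_nonempty n.
  by rewrite -ler0c; apply: le_trans (le z zT); apply: inner_ge0.
apply: ge_sup.
  by have [z zT] := torus_nonempty n; exists (opnorm (peval p z)), z.
move=> _ [z zT <-].
by rewrite opnorm_col norm2_le ?sqrtr_ge0 // sqr_sqrtr // le.
Qed.

End Orthonormal.

(** * Linear polynomials evaluated at rank-one operators *)

Lemma inner_mxcol m (d : 'I_m -> nat) (V W : forall i, 'cV[C]_(d i)) :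
  inner (\mxcol_i V i) (\mxcol_i W i) = \sum_i inner (V i) (W i).
Proof.
rewrite /inner tr_mxcol -summxE -mul_mxrow_mxcol; congr ((_ *m _) 0 0).
by apply/matrixP => i j; rewrite !mxE.
Qed.

Lemma op_eval_linear n d (c : 'I_n -> C) (A : 'I_n -> 'M[C]_d.+1) :
  op_eval (\sum_j c j *: mpolyX C (mnm1 j)) A = \sum_j c j *: A j.
Proof.
rewrite /op_eval raddf_sum; apply: eq_bigr => j _ /=.
by rewrite mmapZ mmapX mmap1U [LHS]mul_scalar_mx.
Qed.

Lemma rank1_suml n d m (c : 'I_n -> C) (v : 'I_n -> 'cV[C]_d) (f : 'cV[C]_m) :
  \sum_j c j *: rank1 (v j) f = rank1 (\sum_j c j *: v j) f.
Proof.
by rewrite /rank1 mulmx_suml; apply: eq_bigr => j _; rewrite scalemxAl.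
Qed.

(** All the operators share the functional [<x, f>], which factors out of both blocks. The one-block
    [\mxcol] is [x] seen in the single-copy direct sum on which [op_peval] acts. *)
Lemma inner_op_peval n d (f1 f2 : 'cV[C]_n) (v : 'I_n -> 'cV[C]_d.+1) f
    (x : 'cV[C]_d.+1)
    (g := fun k => \sum_j ([:: f1; f2]`_k j 0)^* *: v j)
    (y := op_peval (lin_poly f1 f2) (fun j => rank1 (v j) f) *m
      \mxcol_(i < 1) x) :
  inner y y =
    `|inner x f| ^+ 2 * (inner (g 0%N) (g 0%N) + inner (g 1%N) (g 1%N)).
Proof.
have -> : y = \mxcol_(k < 2) (inner x f *: g k).
  rewrite /y /op_peval mul_mxblock_mxrow; apply: eq_mxcol => k.
  by rewrite big_ord1 mxE op_eval_linear rank1_suml rank1E.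
rewrite inner_mxcol big_ord_recl big_ord1 /= !innerZl !innerZr sqr_normc.
by rewrite mulrA [X in _ + X]mulrA -mulrDr.
Qed.

(** * Distance from the torus to the span of [u1] and [u2] *)

(** Here [X] stands for the real part of [a b^*], and [h1], [h2], [h3] for the defects from 1 of the
    squared moduli of [a], [b] and [c a + s b]. In the expansion of the last one the main terms
    cancel by [c ^+ 2 + s ^+ 2 = 1], leaving [2 c s |X| <= 2 eta <= c s / 2]. *)
Lemma re_product_small (c s X x eta h1 h2 h3 : R) :
  c ^+ 2 + s ^+ 2 = 1 -> 0 < x -> x <= c * s -> eta <= x / 4 ->
  c ^+ 2 * (1 + h1) + s ^+ 2 * (1 + h2) + 2 * (c * s) * X = 1 + h3 ->
  `|h1| <= eta -> `|h2| <= eta -> `|h3| <= eta -> `|X| <= 1 / 4.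
Proof.
move=> cs x0 xcs etax E h1e h2e h3e.
have e1 : 2 * (c * s) * X = h3 - c ^+ 2 * h1 - s ^+ 2 * h2.
  have -> : h3 = c ^+ 2 * (1 + h1) + s ^+ 2 * (1 + h2) + 2 * (c * s) * X -
    (c ^+ 2 + s ^+ 2) by rewrite cs E; ring.
  by ring.
have c20 : 0 <= c ^+ 2 by rewrite sqr_ge0.
have s20 : 0 <= s ^+ 2 by rewrite sqr_ge0.
have bound : `|2 * (c * s) * X| <= 2 * eta.
  rewrite e1; apply: le_trans (ler_normB _ _) _.
  have -> : 2 * eta = (eta + c ^+ 2 * eta) + s ^+ 2 * eta.
    by rewrite -addrA -mulrDl cs; ring.
  apply: lerD; last by rewrite normrM ger0_norm // ler_wpM2l.
  apply: le_trans (ler_normB _ _) _.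
  by apply: lerD => //; rewrite normrM ger0_norm // ler_wpM2l.
have cs0 : 0 < c * s by apply: lt_le_trans xcs.
have : (c * s) * `|X| <= (c * s) * (1 / 4).
  move: bound; rewrite normrM ger0_norm; last by rewrite mulr_ge0 // ltW.
  by move=> bound; lra.
by rewrite ler_pM2l.
Qed.

(* If [a], [b], [c1 a + s1 b], [c2 a + i s2 b] are all nearly unimodular, then
   the real and imaginary parts of [a b^*] are both small, although [|a b^*|]
   is near [1]. *)
Lemma not_nearly_unimodular (c1 s1 c2 s2 x y u v m eta : R) :
  c1 ^+ 2 + s1 ^+ 2 = 1 -> c2 ^+ 2 + s2 ^+ 2 = 1 ->
  0 < m -> m <= c1 * s1 -> m <= c2 * s2 -> m <= 1 / 2 -> eta <= m / 4 ->
  `|x ^+ 2 + y ^+ 2 - 1| <= eta -> `|u ^+ 2 + v ^+ 2 - 1| <= eta ->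
  `|(c1 * x + s1 * u) ^+ 2 + (c1 * y + s1 * v) ^+ 2 - 1| <= eta ->
  `|(c2 * x - s2 * v) ^+ 2 + (c2 * y + s2 * u) ^+ 2 - 1| <= eta -> False.
Proof.
move=> cs1 cs2 m0 m1 m2 mh em ha hb h3 h4.
(* With [a = x + i y] and [b = u + i v], [P] bounds the real part of [a b^*]. [Q] bounds its
   imaginary part, because the factor [i] on [s2 b] turns one into the other in the cross term. *)
have P : `|x * u + y * v| <= 1 / 4.
  apply: (re_product_small cs1 m0 m1 em _ ha hb h3); ring.
have Q : `|y * u - x * v| <= 1 / 4.
  apply: (re_product_small cs2 m0 m2 em _ ha hb h4); ring.
have PQ : (x * u + y * v) ^+ 2 + (y * u - x * v) ^+ 2 =
    (x ^+ 2 + y ^+ 2) * (u ^+ 2 + v ^+ 2) by ring.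
have sqr_le t : `|t| <= 1 / 4 -> t ^+ 2 <= 1 / 16 :> R.
  move=> t4; rewrite -real_normK ?num_real //.
  have := normr_ge0 t; nra.
have := sqr_le _ P; have := sqr_le _ Q.
move: ha hb; rewrite !ler_norml => /andP[ha _] /andP[hb _].
(* Since [eta <= m / 4 <= 1 / 8], the right side of [PQ] is at least 49/64, while its left side is
   at most 1/8. *)
have : 7 / 8 <= x ^+ 2 + y ^+ 2 by lra.
have : 7 / 8 <= u ^+ 2 + v ^+ 2 by lra.
move: PQ; move: (x ^+ 2 + y ^+ 2) (u ^+ 2 + v ^+ 2) => A B.
move: ((x * u + y * v) ^+ 2) ((y * u - x * v) ^+ 2) => S T.
nra.
Qed.

(** With [delta = z - w], the quantity [|w| ^+ 2 - 1] is [|delta| ^+ 2 - 2 Re (z^* delta)], of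
    modulus at most [e ^+ 2 + 2 e <= 3 e]. *)
Lemma nearly_unimodular (z w : C) (e : R) : 0 < e -> e <= 1 -> `|z| = 1 ->
  `|z - w| ^+ 2 <= (e ^+ 2)%:C ->
  `|complex.Re w ^+ 2 + complex.Im w ^+ 2 - 1| <= 3 * e.
Proof.
move=> e0 e1 z1; rewrite -add_Re2_Im2 lecR.
have : complex.Re z ^+ 2 + complex.Im z ^+ 2 = 1.
  by apply: complexI; rewrite add_Re2_Im2 z1 expr1n.
case: z z1 => p q _; case: w => x y /= pq.
set d := p - x; set d' := q - y => de.
have [-> ->] : x = p - d /\ y = q - d' by rewrite !subKr.
(* Cauchy-Schwarz by Lagrange's identity, using [p ^+ 2 + q ^+ 2 = 1]. *)
have cs : (p * d + q * d') ^+ 2 <= e ^+ 2.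
  have : (p * d + q * d') ^+ 2 + (p * d' - q * d) ^+ 2 =
     (p ^+ 2 + q ^+ 2) * (d ^+ 2 + d' ^+ 2) by ring.
  rewrite pq mul1r => E; apply: le_trans de; rewrite -E lerDl; exact: sqr_ge0.
have -> : (p - d) ^+ 2 + (q - d') ^+ 2 - 1 =
    (d ^+ 2 + d' ^+ 2) - 2 * (p * d + q * d').
  by rewrite -[X in _ - X = _]pq; ring.
have : `|p * d + q * d'| <= e.
  by rewrite -ler_sqr ?nnegrE ?(ltW e0) // real_normK ?num_real.
have : 0 <= d ^+ 2 + d' ^+ 2 by rewrite addr_ge0 ?sqr_ge0.
move: de; move: (d ^+ 2 + d' ^+ 2) (p * d + q * d') => D P.
rewrite !ler_norml => De D0 /andP[P1 P2]; apply/andP; split; nra.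
Qed.

(** Each entry of [w] is bounded by its norm, so a smaller [w] would make all four entries of
    [a *: u1 + b *: u2] nearly unimodular. *)
Lemma torus_dist_span (c1 s1 c2 s2 m : R) (z : 'I_4 -> C) (a b : C)
    (u1 := \col_j [:: 1; 0; c1%:C; c2%:C]`_j : 'cV[C]_4)
    (u2 := \col_j [:: 0; 1; s1%:C; 'i * s2%:C]`_j : 'cV[C]_4)
    (w := \col_j z j - (a *: u1 + b *: u2)) :
  c1 ^+ 2 + s1 ^+ 2 = 1 -> c2 ^+ 2 + s2 ^+ 2 = 1 ->
  0 < m -> m <= c1 * s1 -> m <= c2 * s2 -> m <= 1 / 2 -> torus z ->
  ((m / 12) ^+ 2)%:C <= inner w w.
Proof.
move=> cs1 cs2 m0 m1 m2 mh zT.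
rewrite -sqr_norm2 lecR leNgt; apply/negP => lt_w.
(* The 12 makes the defect [3 * e] from [nearly_unimodular] equal to [m / 4], the tolerance of
   [not_nearly_unimodular]. *)
pose e := m / 12.
have e0 : 0 < e by rewrite divr_gt0.
have e1 : e <= 1 by rewrite /e; lra.
have near j : `|complex.Re ((a *: u1 + b *: u2) j 0) ^+ 2 +
    complex.Im ((a *: u1 + b *: u2) j 0) ^+ 2 - 1| <= 3 * e.
  apply: (nearly_unimodular e0 e1 (zT j)).
  apply: (@le_trans _ _ (inner w w)).
    rewrite innervv (bigD1 j) //= -[X in X <= _]addr0.
    have -> : w j 0 = z j - (a *: u1 + b *: u2) j 0.
      by rewrite /w mxE [X in X + _]mxE [X in _ + X]mxE.
    rewrite lerD2l.
    by rewrite sumr_ge0 // => i _; rewrite exprn_ge0.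
  by rewrite -sqr_norm2 lecR ltW.
have em : 3 * e <= m / 4 by rewrite /e; lra.
have /= := near (Ordinal (isT : (3 < 4)%N)).
have /= := near (Ordinal (isT : (2 < 4)%N)).
have /= := near (Ordinal (isT : (1 < 4)%N)).
have /= := near (Ordinal (isT : (0 < 4)%N)).
rewrite !mxE /=.
case: {w lt_w near} a => x y; case: b => u v /=.
rewrite !(mulr0, mulr1, mul0r, mul1r, addr0, add0r, subr0, sub0r, oppr0).
move=> H1 H2 H3 H4.
apply: (not_nearly_unimodular cs1 cs2 m0 m1 m2 mh em H1 H2).
- by move: H3; congr (`|_| <= _); ring.
- by move: H4; congr (`|_| <= _); ring.
Qed.

End ComplexVectors.

(** * The four rank-one operators on a three-dimensional space *)

Theorem proposition3p3 (R : realType) (f e1 e2 : 'cV[R[i]]_3)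
    (Hbasis : orthonormal_seq [:: f; e1; e2])
    (theta1 theta2 : R)
    (Htheta1 : 0 < theta1 < pi / 2) (Htheta2 : 0 < theta2 < pi / 2) :
  let c1 : R[i] := (cos theta1)%:C in
  let s1 : R[i] := (sin theta1)%:C in
  let c2 : R[i] := (cos theta2)%:C in
  let s2 : R[i] := (sin theta2)%:C in
  let A (j : 'I_4) : 'M[R[i]]_3 :=
    [:: rank1 e1 f;
        rank1 e2 f;
        rank1 (c1 *: e1 + s1 *: e2) f;
        rank1 (c2 *: e1 + ('i * s2) *: e2) f]`_j in
  let u1 : 'cV[R[i]]_4 := \col_j [:: 1; 0; c1; c2]`_j in
  let u2 : 'cV[R[i]]_4 := \col_j [:: 0; 1; s1; 'i * s2]`_j in
  let f1 := (gram_schmidt [:: u1; u2])`_0 in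
  let f2 := (gram_schmidt [:: u1; u2])`_1 in
  let p : 'cV[mpoly 4 R[i]]_2 :=
    \col_k \sum_(j < 4) ([:: f1; f2]`_k j 0)^* *: mpolyX R[i] (mnm1 j) in
  [/\ pnorm p = psup (@torus R 4) p,
      psup (@torus R 4) p < 2,
      opnorm (op_peval p A) = 2
    & ~ matrix_von_neumann A].
Proof.
move=> c1 s1 c2 s2 A u1 u2 f1 f2 p.
have u1_neq0 : u1 != 0.
  by apply/eqP => /colP/(_ 0); rewrite !mxE; apply/eqP; rewrite oner_eq0.
have u2_neq k : u2 != k *: u1.
  apply/eqP => /colP u2E.
  have k0 : k = 0 by have := u2E 0; rewrite !mxE /= mulr1.
  have := u2E (Ordinal (isT : (1 < 4)%N)); rewrite k0 !mxE /= mul0r.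
  by apply/eqP; rewrite oner_eq0.
have [f11 f22 f12 [a [b [c [a0 b0 u1E u2E]]]]] := gram_schmidt2 u1_neq0 u2_neq.
have pE : p = lin_poly f1 f2 by [].
rewrite -/f1 -/f2 in f11 f22 f12 u1E u2E.
clearbody p f1 f2.
have pnormE : pnorm p = psup (@torus R 4) p by rewrite pE pnorm_lin_poly.
have cs1 := cos2Dsin2 theta1; have cs2 := cos2Dsin2 theta2.
have cos_sin_gt0 t : 0 < t < pi / 2 -> 0 < cos t * sin t :> R.
  move=> /andP[t0 t1]; apply: mulr_gt0.
    rewrite cos_gt0_pihalf // t1 andbT (lt_trans _ t0) //.
    by rewrite oppr_lt0 divr_gt0 ?pi_gt0.
  rewrite sin_gt0_pi // t0 (lt_trans t1) // ltr_pdivrMr // ltr_pMr ?pi_gt0 //.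
  by rewrite ltr1n.
have lt2 : psup (@torus R 4) p < 2.
  pose m := Num.min (cos theta1 * sin theta1) (cos theta2 * sin theta2).
  have m0 : 0 < m by rewrite lt_min !cos_sin_gt0.
  have m1 : m <= cos theta1 * sin theta1 by rewrite ge_min lexx.
  have m2 : m <= cos theta2 * sin theta2 by rewrite ge_min lexx orbT.
  have mh : m <= 1 / 2.
    by apply: le_trans m1 _; have := sqr_ge0 (cos theta1 - sin theta1); nra.
  have -> : 2 = Num.sqrt 4%:R :> R.
    by rewrite (_ : 4%:R = 2 ^+ 2) ?sqrtr_sqr ?normr_nat // -natrX.
  rewrite pE; apply: (@psup_torus_lt _ _ _ _ f11 f22 f12 ((m / 12) ^+ 2)) => //.
    by rewrite exprn_gt0 // divr_gt0.
  move=> z x y zT /=.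
  (* Inverting the triangular relations rewrites a combination of [f1], [f2] as one of [u1], [u2],
     for which the distance bound is available. *)
  have f1E : f1 = a^-1 *: u1 by rewrite u1E scalerA mulVf // scale1r.
  have f2E : f2 = b^-1 *: (u2 - c *: f1).
    by rewrite u2E addrK scalerA mulVf // scale1r.
  have -> : x *: f1 + y *: f2 =
      (a^-1 * (x - y / b * c)) *: u1 + (y / b) *: u2.
    rewrite f2E f1E scalerBr scalerBr !scalerA addrCA addrC -scalerBl.
    by congr (_ *: _ + _); ring.
  exact: (torus_dist_span _ _ cs1 cs2 m0 m1 m2 mh zT).
have e0 i j (ii : (i < 3)%N) (jj : (j < 3)%N) := Hbasis i j ii jj.
have ff : inner f f = 1 := e0 0%N 0%N isT isT.
have e11 : inner e1 e1 = 1 := e0 1%N 1%N isT isT.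
have e12 : inner e1 e2 = 0 := e0 1%N 2%N isT isT.
have e22 : inner e2 e2 = 1 := e0 2%N 2%N isT isT.
pose v (j : 'I_4) := u1 j 0 *: e1 + u2 j 0 *: e2.
have AE : A = fun j => rank1 (v j) f.
  apply/funext => -[[|[|[|[|//]]]] lt_j]; rewrite /A /v !mxE /=.
  - by rewrite scale1r scale0r addr0.
  - by rewrite scale1r scale0r add0r.
  - by [].
  - by [].
(* Exchanging the two sums turns the coefficients on [e1] and [e2] into inner products of [u1] and
   [u2] with [g]. *)
have gE (g : 'cV[R[i]]_4) :
    \sum_j (g j 0)^* *: v j = inner u1 g *: e1 + inner u2 g *: e2.
  rewrite !innerE !scaler_suml -big_split; apply: eq_bigr => j _ /=.
  by rewrite scalerDr !scalerA ![_^* * _]mulrC.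
have inner_g (g : 'cV[R[i]]_4) (s := \sum_j (g j 0)^* *: v j) :
    inner s s = `|inner u1 g| ^+ 2 + `|inner u2 g| ^+ 2.
  by rewrite /s gE inner_comb2.
have total : inner u1 u1 + inner u2 u2 = 4.
  have normR (r : R) : `|r%:C| ^+ 2 = (r ^+ 2)%:C.
    by rewrite -add_Re2_Im2 /= expr0n addr0.
  have normiR (r : R) : `|'i * r%:C| ^+ 2 = (r ^+ 2)%:C.
    by rewrite -add_Re2_Im2; congr _%:C => /=; ring.
  rewrite !innervv !big_ord_recl !big_ord0 !mxE /= normiR !normR.
  rewrite !addr0 -!rmorphD -[RHS](rmorph_nat (real_complex R)) /=.
  by congr _%:C; rewrite expr1n expr0n /=; lra.
have f21 : inner f2 f1 = 0 by rewrite innerC f12 rmorph0.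
(* Regrouped by [u1] and [u2], this is Parseval in the span of [f1] and [f2]; the term [<u1, f2>]
   vanishes. *)
have sum_g : (`|inner u1 f1| ^+ 2 + `|inner u2 f1| ^+ 2) +
    (`|inner u1 f2| ^+ 2 + `|inner u2 f2| ^+ 2) = 4.
  rewrite -total u2E inner_comb2 // u1E.
  rewrite !(innerDl, innerZl, innerZr) f11 f22 f12 f21 sqr_normc.
  rewrite !(mulr0, mulr1, addr0, add0r) normr0 expr0n /= add0r.
  by rewrite -addrA [X in _ = _ + X]addrC.
have inner_pA x : inner (op_peval p A *m x) (op_peval p A *m x) =
    `|inner (submxcol x ord0) f| ^+ 2 * 4.
  have xE : x = \mxcol_(i < 1) submxcol x ord0.
    by rewrite -[LHS]submxcolK; apply: eq_mxcol => j; rewrite ord1.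
  by rewrite [in LHS]xE AE pE inner_op_peval /= !inner_g sum_g.
have opnormE : opnorm (op_peval p A) = 2.
  (* The norm is attained at the unit vector [f]; the upper bound is Cauchy-Schwarz for [<x, f>]. *)
  apply: (@opnorm_eq _ _ _ _ _ (\mxcol_(i < 1) f)) => //.
  - move=> x; rewrite norm2_le ?mulr_ge0 ?norm2_ge0 // inner_pA.
    rewrite exprMn mulrC rmorphM /= sqr_norm2 -[in leRHS](submxcolK x).
    rewrite inner_mxcol big_ord1 -natrX rmorph_nat ler_wpM2l ?ler0n //.
    exact: cauchy_schwarz1.
  - by apply: norm2_eq => //; rewrite inner_mxcol big_ord1 ff expr1n.
  - apply: norm2_eq => //; rewrite inner_pA mxcolK ff normr1 expr1n mul1r.
    by rewrite -natrX rmorph_nat.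
split=> // vN; have := vN _ _ p.
by rewrite opnormE pnormE leNgt lt2.
Qed.
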